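(* For every planar graph $G$, there exists a forest $F$ in $G$ such that $G-E(F)$ has Alon-Tarsi number at most three.
   Context: For a graph $G$, associate a variable $x_v$ to each vertex $v$, fix a linear order $<$ on $V(G)$, and let $P_G(\mathbf{x})=\prod_{uv\in E(G),\,u<v}(x_v-x_u)$. The Alon-Tarsi number $AT(G)$ is the minimum integer $k$ such that for some function $\eta:V(G)\to\mathbb{Z}_{\ge 0}$ with $\eta(v)<k$ for all $v$, the coefficient of the monomial $\prod_{v}x_v^{\eta(v)}$ in the expansion of $P_G$ is nonzero. Equivalently, $AT(G)$ is the minimum $k$ such that $G$ has an orientation $D$ with $d^+_D(v)<k$ for all $v$ and with the number of spanning Eulerian sub-digraphs of $D$ having an even number of arcs different from the number having an odd number of arcs. *)

(* Defs.v *)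
From Stdlib Require Import Reals.
From mathcomp Require Import all_boot all_order all_algebra.
From mathcomp Require Import mpoly.
Set Implicit Arguments. Unset Strict Implicit. Unset Printing Implicit Defensive.
Import Order.TTheory GRing.Theory.

Definition simple_graph (T : finType) (e : rel T) : Prop :=
  ssrbool.symmetric e /\ irreflexive e.

Definition pt := (R * R)%type.

Definition dist2 (p q : pt) : R :=
  Rmax (Rabs (Rminus (fst p) (fst q))) (Rabs (Rminus (snd p) (snd q))).

Definition in01 (t : R) : Prop := Rle R0 t /\ Rle t R1.
Definition in01o (t : R) : Prop := Rlt R0 t /\ Rlt t R1.

(* f : R -> R^2 continuous on [0,1] (relative topology); the max-norm
   induces the Euclidean topology of R^2. *)
Definition cont01 (f : R -> pt) : Prop :=
  forall t : R, in01 t -> forall eps : R, Rlt R0 eps ->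
    exists delta : R, Rlt R0 delta /\
      forall s : R, in01 s -> Rlt (Rabs (Rminus s t)) delta ->
        Rlt (dist2 (f s) (f t)) eps.

Definition inj01 (f : R -> pt) : Prop :=
  forall s t : R, in01 s -> in01 t -> f s = f t -> s = t.

Definition planar (T : finType) (e : rel T) : Prop :=
  exists (p : T -> pt) (arc : T -> T -> R -> pt),
    injective p /\
    forall u v, e u v ->
      cont01 (arc u v) /\ inj01 (arc u v) /\
      arc u v R0 = p u /\ arc u v R1 = p v /\
      (forall (t : R) w, in01o t -> arc u v t <> p w) /\
          (forall u' v', e u' v' ->
             ~ ((u = u' /\ v = v') \/ (u = v' /\ v = u')) ->
             forall s t : R, in01 s -> in01 t ->
               arc u v s = arc u' v' t ->
               exists w, (w = u \/ w = v) /\ (w = u' \/ w = v') /\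
                         arc u v s = p w).

Definition acyclic (T : finType) (f : rel T) : Prop :=
  ~ exists s : seq T, [/\ 3 <= size s, uniq s & cycle f s].

Definition forest_in (T : finType) (e f : rel T) : Prop :=
  [/\ ssrbool.symmetric f, subrel f e & acyclic f].

Definition remove_edges (T : finType) (e f : rel T) : rel T :=
  fun u v => e u v && ~~ f u v.

Local Open Scope ring_scope.

Definition graph_poly (T : finType) (e : rel T) : {mpoly int[#|T|]} :=
  \prod_(u : T) \prod_(v : T | (enum_rank u < enum_rank v)%N && e u v)
     ('X_(enum_rank v) - 'X_(enum_rank u)).

Definition mono_of (T : finType) (eta : T -> nat) : 'X_{1..#|T|} :=
  [multinom eta (enum_val i) | i < #|T|].

Definition AT_ok (T : finType) (e : rel T) (k : nat) : bool :=
  [exists eta : {ffun T -> 'I_k},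
     (graph_poly e)@_(mono_of (fun v => nat_of_ord (eta v))) != 0].

(* AT(G) = least k with AT_ok; the search bound N = #|T|^2 + 1 is safe since
   every exponent in the support is at most |E(G)| < N, so AT_ok e N holds. *)
Definition AT_bound (T : finType) : nat := (#|T| ^ 2).+1.

Definition alon_tarsi_number (T : finType) (e : rel T) : nat :=
  \big[minn/AT_bound T]_(k < (AT_bound T).+1 | AT_ok e k) (k : nat).

(* Main.v *)
(** If S is a connected vertex set of a planar graph G and B is the set of
    outside neighbours of S, then G[B] has no K4 minor, since contracting S would
    complete it to a K5 minor; as graphs of minimum degree 3 have a K4 minor, some v in B
    has at most two neighbours in B.  Adding such a v to S repeatedly (within each
    component) lists all vertices.  Let F consist of the edges joining each u to its
    first neighbour in the list, when that neighbour precedes u: a cycle of F would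
    have two distinct such edges at its last vertex.  Orient the other edges from the
    earlier to the later end: when v is listed, the heads of its out-edges already belong
    to B, so v has out-degree at most 2.  This orientation is acyclic, hence its out-degree
    monomial is the leading monomial of the graph polynomial for a suitable order.

    K5 minors are excluded by a parity argument: for two disjoint paths P and Q
    the differences P(s) - Q(t) avoid 0, so the mod 2 winding number of their restriction
    to the boundary of the parameter square vanishes; summing over the 15 pairs of
    disjoint edges of K5 gives 1 = 0. *)
Require Import Defs.
From Stdlib Require Import Reals Lra Classical.
From mathcomp Require Import all_boot all_order all_algebra perm.
From mathcomp Require Import mpoly.
Set Implicit Arguments. Unset Strict Implicit. Unset Printing Implicit Defensive.

(** * Clique minors and the parity identity behind the non-planarity of [K_5] *)

Definition between (T : finType) n (c : T -> option 'I_n) (e : rel T) i j : rel T :=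
  fun x y => [&& e x y, c x \in [:: Some i; Some j] & c y \in [:: Some i; Some j]].

(* K_n minors: the colour classes are the branch sets, with representatives p i; only
   connectivity of the union of any two of them is required. *)
Definition clique_model (T : finType) n (e : rel T) : Prop :=
  exists (c : T -> option 'I_n) (p : 'I_n -> T), (forall i, c (p i) = Some i) /\
    forall i j, i != j -> connect (between c e i j) (p i) (p j).

(* In each of the 5 sets of four indices, the three pairings contribute an odd number
   of reversals [s j i = ~~ s i j], while every [h i j k] occurs twice. *)
Lemma pairing_parity (h : 'I_5 -> 'I_5 -> 'I_5 -> bool) (s : rel 'I_5) :
  (forall i j, i != j -> s j i = ~~ s i j) ->
  (forall i j k l, uniq [:: i; j; k; l] ->
     h i j k (+) h i j l (+) h k l i (+) h k l j
     (+) (s k i (+) s k j (+) s l i (+) s l j) = false) -> False.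
Proof.
move=> sN hs.
pose o i (lt : i < 5) : 'I_5 := Ordinal lt.
pose a := o 0 isT; pose b := o 1 isT; pose c := o 2 isT.
pose d := o 3 isT; pose f := o 4 isT.
pose E i j k l := h i j k (+) h i j l (+) h k l i (+) h k l j
  (+) (s k i (+) s k j (+) s l i (+) s l j).
pose total := E a b c d (+) E a c b d (+) E a d b c (+) E a b c f (+) E a c b f (+)
  E a f b c (+) E a b d f (+) E a d b f (+) E a f b d (+) E a c d f (+)
  E a d c f (+) E a f c d (+) E b c d f (+) E b d c f (+) E b f c d.
suff : total = true by rewrite /total /E !hs.
have addbE x y : x (+) y = xorb x y by case: x; case: y.
have negbE x : ~~ x = xorb true x by case: x.
by rewrite /total /E ?(sN a b isT) ?(sN a c isT) ?(sN a d isT) ?(sN a f isT) ?(sN b c isT)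
  ?(sN b d isT) ?(sN b f isT) ?(sN c d isT) ?(sN c f isT) ?(sN d f isT) !addbE !negbE;
  ring.
Qed.

(** * Parity of crossings *)

Section Drawing.
Local Open Scope R_scope.

(* Compactness of [0,1]: any positive bound that exists locally exists uniformly. *)
Lemma locally_uniform (Q : R -> R -> Prop) :
  (forall s d d', Q s d -> d' <= d -> Q s d') ->
  (forall s, in01 s -> exists d, 0 < d /\
     forall s', in01 s' -> Rabs (s' - s) < d -> Q s' d) ->
  exists d, 0 < d /\ forall s, in01 s -> Q s d.
Proof.
move=> Qmono Qloc.
(* The local bound at the supremum [m] of the good prefixes must reach past 1; otherwise it would
   yield a good prefix longer than [m]. *)
pose good x := 0 <= x <= 1 /\ exists d, 0 < d /\ forall s, 0 <= s <= x -> Q s d.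
have good0 : good 0.
  have [|d [d0 Qd]] := Qloc 0; first by split; lra.
  split; first lra; exists d; split=> // s hs.
  by apply: Qd; [split; lra | split_Rabs; lra].
have [m [mub mlub]] : { m | is_lub good m }.
  apply: completeness; last by exists 0.
  by exists 1 => x [] [].
have m0 : 0 <= m by apply: mub.
have m1 : m <= 1 by apply: mlub => x [] [].
have [|d [d0 Qd]] := Qloc m; first by split; lra.
have [x [[x01 [d' [d'0 Qd']]] xm]] : exists x, good x /\ m - d < x.
  apply: NNPP => no; have : m <= m - d; last lra.
  apply: mlub => x gx; apply: Rnot_lt_le => mx; apply: no; by exists x.
have xlem : x <= m by apply: mub; split=> //; exists d'.
pose d2 := Rmin d d'.
have d2d : d2 <= d by apply: Rmin_l.
have d2d' : d2 <= d' by apply: Rmin_r.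
have d20 : 0 < d2 by apply: Rmin_pos.
have Qall s : 0 <= s <= 1 -> s < m + d -> Q s d2.
  move=> s01 sm; case: (Rle_lt_dec s x) => sx.
    by apply: (Qmono _ d') => //; apply: Qd'; lra.
  by apply: (Qmono _ d) => //; apply: Qd; [split; lra | split_Rabs; lra].
have : 1 < m + d.
  apply: Rnot_le_lt => md.
  have : m + d / 2 <= m; last lra.
  apply: mub; split; first lra.
  by exists d2; split=> // s hs; apply: Qall; lra.
by move=> md; exists d2; split=> // s [s0 s1]; apply: Qall; lra.
Qed.

Lemma dist2_lt (p q : pt) d :
  dist2 p q < d <-> Rabs (p.1 - q.1) < d /\ Rabs (p.2 - q.2) < d.
Proof.
rewrite /dist2; split.
  by move=> h; split; apply: Rle_lt_trans h; [apply: Rmax_l | apply: Rmax_r].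
by case=> h1 h2; apply: Rmax_lub_lt.
Qed.

Lemma dist2_sym p q : dist2 p q = dist2 q p.
Proof. by rewrite /dist2 Rabs_minus_sym (Rabs_minus_sym (snd p)). Qed.

Lemma dist2_triangle p q r d d' :
  dist2 p q < d -> dist2 q r < d' -> dist2 p r < d + d'.
Proof.
move=> /dist2_lt [h1 h2] /dist2_lt [h3 h4]; apply/dist2_lt.
by split; split_Rabs; lra.
Qed.

Lemma dist2_gt0 p q : p <> q -> 0 < dist2 p q.
Proof.
move=> npq; apply: Rnot_le_lt => h; apply: npq.
have h1 := Rle_trans _ _ _ (Rmax_l _ _) h.
have h2 := Rle_trans _ _ _ (Rmax_r _ _) h.
case: p q h1 h2 {h} => [a b] [c d] /= h1 h2.
have -> : a = c by split_Rabs; lra.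
by have -> : b = d by split_Rabs; lra.
Qed.

(** Heine-Cantor theorem, with the local modulus halved so that both points stay within its
    reach. *)
Lemma cont01_uniform f eps : cont01 f -> 0 < eps ->
  exists d, 0 < d /\ forall s t, in01 s -> in01 t -> Rabs (t - s) < d ->
    dist2 (f s) (f t) < eps.
Proof.
move=> cf eps0.
have [|s s01|d [d0 Qd]] := @locally_uniform (fun s d => forall t, in01 t ->
    Rabs (t - s) < d -> dist2 (f s) (f t) < eps).
- by move=> s d d' Qd le_d' t t01 ts; apply: Qd => //; lra.
- have [|d [d0 fd]] := cf s s01 (eps / 2); first lra.
  exists (d / 2); split; first lra.
  move=> s' s'01 s's t t01 ts'.
  replace eps with (eps / 2 + eps / 2) by lra.
  apply: (@dist2_triangle _ (f s)).
    by apply: fd => //; lra.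
  by rewrite dist2_sym; apply: fd => //; split_Rabs; lra.
- by exists d; split=> // s t s01 t01; apply: Qd.
Qed.

Lemma cont01_separated f g : cont01 f -> cont01 g ->
  (forall s t, in01 s -> in01 t -> f s <> g t) ->
  exists d, 0 < d /\ forall s t, in01 s -> in01 t -> d <= dist2 (f s) (g t).
Proof.
move=> cf cg fg.
suff [d [d0 Qd]] : exists d, 0 < d /\
    forall s, in01 s -> forall t, in01 t -> d <= dist2 (f s) (g t).
  by exists d; split=> // s t s01; apply: Qd.
apply: (@locally_uniform (fun s d => forall t, in01 t -> d <= dist2 (f s) (g t))).
  by move=> s d d' Qd le_d' t t01; have := Qd t t01; lra.
move=> s s01.
have [|t t01|d [d0 Qd]] := @locally_uniform (fun t d => d <= dist2 (f s) (g t)).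
- by move=> t d d' ? ?; lra.
- have D0 := dist2_gt0 (fg _ _ s01 t01).
  have [|d [d0 gd]] := cg t t01 (dist2 (f s) (g t) / 2); first lra.
  exists (Rmin d (dist2 (f s) (g t) / 2)); split; first by apply: Rmin_pos; lra.
  move=> t' t'01 t't; apply: Rnot_lt_le => lt.
  have := Rmin_l d (dist2 (f s) (g t) / 2).
  have := Rmin_r d (dist2 (f s) (g t) / 2) => h1 h2.
  have := @dist2_triangle (f s) (g t') (g t) _ _ lt (gd t' t'01 _); lra.
- have [|d' [d'0 fd]] := cf s s01 (d / 2); first lra.
  exists (Rmin d' (d / 2)); split; first by apply: Rmin_pos; lra.
  move=> s' s'01 s's t t01; apply: Rnot_lt_le => lt.
  have := Rmin_l d' (d / 2); have := Rmin_r d' (d / 2) => h1 h2.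
  have := Qd t t01.
  have := @dist2_triangle (f s) (f s') (g t) (d / 2) (d / 2).
  rewrite (dist2_sym (f s)) => h; have := h (fd _ s'01 _); lra.
Qed.

Lemma common_bound (I : finType) (Q : I -> R -> Prop) :
  (forall i d d', Q i d -> d' <= d -> Q i d') ->
  (forall i, exists d, 0 < d /\ Q i d) ->
  exists d, 0 < d /\ forall i, Q i d.
Proof.
move=> Qmono Qex.
suff [d [d0 Qd]] : exists d, 0 < d /\ forall i, i \in enum I -> Q i d.
  by exists d; split=> // i; apply: Qd; rewrite mem_enum.
elim: (enum I) => [|i s [d [d0 Qd]]]; first by exists 1; split=> //; lra.
have [d' [d'0 Qd']] := Qex i.
exists (Rmin d d'); split; first exact: Rmin_pos.
move=> j; rewrite inE => /orP [/eqP -> | js].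
  by apply: (Qmono _ d') => //; apply: Rmin_r.
by apply: (Qmono _ d); [apply: Qd | apply: Rmin_l].
Qed.

(** * Difference vectors and their crossings of the upper half axis *)

Definition sub2 (p q : pt) : pt := (p.1 - q.1, p.2 - q.2).
(** [norm2 (sub2 p q)] is convertible to [dist2 p q], so [far] supplies its lower bounds
    directly. *)
Definition norm2 (z : pt) := Rmax (Rabs z.1) (Rabs z.2).

(* Side of the vertical axis; ties are broken on the axis so that exactly one of
   z and -z is positive for every nonzero z, and no general position is needed. *)
Definition lexpos (z : pt) : bool :=
  (if Rlt_dec 0 z.1 then true else false) ||
  (if Rlt_dec z.1 0 then false else if Rlt_dec 0 z.2 then true else false).
Definition above (z : pt) : bool := if Rlt_dec 0 z.2 then true else false.
(* For close points far from 0: the step from z to z' crosses the upper half axis. *)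
Definition crossing (z z' : pt) : bool :=
  (lexpos z (+) lexpos z') && above z.

Lemma lexposN p q : p <> q -> lexpos (sub2 q p) = ~~ lexpos (sub2 p q).
Proof.
case: p q => [a b] [c d] npq; rewrite /lexpos /sub2 /=.
do ![case: Rlt_dec => ? //=]; try lra.
by case: npq; congr pair; lra.
Qed.

(** A short step between the two sides keeps both first coordinates below [d] in absolute value; the
    second coordinates are then at least [d] in absolute value and cannot have opposite signs. *)
Lemma lexpos_change d z z' : d <= norm2 z -> d <= norm2 z' ->
  dist2 z z' < d -> lexpos z != lexpos z' -> above z = above z' /\ z.2 <> 0.
Proof.
move=> nz nz' /dist2_lt [zz1 zz2] neq.
have [z1 z1'] : Rabs z.1 < d /\ Rabs z'.1 < d.
  move: neq; rewrite /lexpos.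
  by do ![case: Rlt_dec => ? //=] => _; split; split_Rabs; lra.
have z2 : d <= Rabs z.2.
  apply: Rnot_lt_le => h; have := Rmax_lub_lt _ _ _ z1 h.
  by rewrite -/(norm2 z); lra.
have z2' : d <= Rabs z'.2.
  apply: Rnot_lt_le => h; have := Rmax_lub_lt _ _ _ z1' h.
  by rewrite -/(norm2 z'); lra.
by split; [rewrite /above; do ![case: Rlt_dec => ? //=]|]; split_Rabs; lra.
Qed.

(** If both sides occur among the corners, [above] agrees on any two corners on opposite sides,
    diagonals included, hence is constant; and a closed walk changes sides an even number of
    times. *)
Lemma crossing_square d A B C D :
  d <= norm2 A -> d <= norm2 B -> d <= norm2 C -> d <= norm2 D ->
  dist2 A B < d -> dist2 A C < d -> dist2 A D < d -> dist2 B C < d ->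
  dist2 B D < d -> dist2 C D < d ->
  crossing A B (+) crossing B C (+) crossing D C (+) crossing A D = false.
Proof.
move=> nA nB nC nD AB AC AD BC BD CD; rewrite /crossing.
have same z z' : d <= norm2 z -> d <= norm2 z' -> dist2 z z' < d ->
    (lexpos z != lexpos z') ==> (above z == above z').
  by move=> nz nz' zz'; apply/implyP => /(lexpos_change nz nz' zz') [-> _].
move: (same _ _ nA nB AB) (same _ _ nA nC AC) (same _ _ nA nD AD).
move: (same _ _ nB nC BC) (same _ _ nB nD BD) (same _ _ nC nD CD).
by case: (lexpos A); case: (lexpos B); case: (lexpos C); case: (lexpos D);
   case: (above A); case: (above B); case: (above C); case: (above D).
Qed.

(** Edges of the parameter square: [crossings] moves the minuend of the difference, [rcrossings] the
    subtrahend. *)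
Fixpoint crossings (q x : pt) (s : seq pt) : bool :=
  if s is y :: s' then crossing (sub2 x q) (sub2 y q) (+) crossings q y s' else false.

Fixpoint rcrossings (q x : pt) (s : seq pt) : bool :=
  if s is y :: s' then crossing (sub2 q x) (sub2 q y) (+) rcrossings q y s' else false.

Fixpoint steps (d : R) (x : pt) (s : seq pt) : Prop :=
  if s is y :: s' then dist2 x y < d /\ steps d y s' else True.

Definition far (d : R) (p q : pt) := d <= dist2 p q.

Lemma dist2_sub p q p' q' d :
  dist2 p p' < d / 2 -> dist2 q q' < d / 2 -> dist2 (sub2 p q) (sub2 p' q') < d.
Proof.
move=> /dist2_lt [h1 h2] /dist2_lt [h3 h4]; apply/dist2_lt => /=.
by split; split_Rabs; lra.
Qed.

Lemma dist2xx p d : 0 < d -> dist2 p p < d.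
Proof. by move=> d0; apply/dist2_lt; split; split_Rabs; lra. Qed.

Lemma dist2C p q d : dist2 p q < d -> dist2 q p < d.
Proof. by rewrite dist2_sym. Qed.

Ltac case_booleans := repeat match goal with
  | |- context [crossing ?a ?b] => case: (crossing a b)
  | |- context [crossings ?a ?b ?c] => case: (crossings a b c)
  | |- context [rcrossings ?a ?b ?c] => case: (rcrossings a b c)
  | |- context [above ?a] => case: (above a)
  | |- context [lexpos ?a] => case: (lexpos a)
  end.

(** One row of small squares: inner sides cancel in pairs, leaving the boundary of the row. *)
Lemma crossings_strip d x x' y t : 0 < d -> dist2 x x' < d / 2 -> steps (d / 2) y t ->
  (forall b, List.In b (y :: t) -> far d x b) ->
  (forall b, List.In b (y :: t) -> far d x' b) ->
  crossing (sub2 x y) (sub2 x' y) (+) rcrossings x' y t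
  (+) crossing (sub2 x (last y t)) (sub2 x' (last y t)) (+) rcrossings x y t = false.
Proof.
move=> d0 xx'; elim: t y => [|z t IH] y /=; first by rewrite !addbF => *; apply: addbb.
move=> [yz st] fx fx'.
have {}IH := IH _ st (fun b h => fx b (or_intror h)) (fun b h => fx' b (or_intror h)).
have d20 : 0 < d / 2 by lra.
(* Steps are bounded by [d / 2] so that diagonals, along which both points move, stay shorter than
   [d]. *)
have := @crossing_square d (sub2 x y) (sub2 x' y) (sub2 x' z) (sub2 x z).
have fy : List.In y (y :: z :: t) by left.
have fz : List.In z (y :: z :: t) by right; left.
move=> h; move: (h (fx _ fy) (fx' _ fy) (fx' _ fz) (fx _ fz)) IH => {h} h.
have {h} := h (dist2_sub xx' (dist2xx _ d20)) (dist2_sub xx' yz)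
  (dist2_sub (dist2xx _ d20) yz) (dist2_sub (dist2xx _ d20) yz)
  (dist2_sub (dist2C xx') yz) (dist2_sub (dist2C xx') (dist2xx _ d20)).
by case_booleans.
Qed.

(** Stacking the rows: the discrete winding number mod 2 along the boundary of the parameter square
    vanishes. *)
Lemma crossings_grid d x s y t : 0 < d -> steps (d / 2) x s -> steps (d / 2) y t ->
  (forall a b, List.In a (x :: s) -> List.In b (y :: t) -> far d a b) ->
  crossings y x s (+) rcrossings (last x s) y t
  (+) crossings (last y t) x s (+) rcrossings x y t = false.
Proof.
move=> d0; elim: s x => [|x' s IH] x /= sx sy fxy; first by rewrite addbF addbb.
case: sx => xx' sx.
have {}IH := IH _ sx sy (fun a b h => fxy a b (or_intror h)).
have := crossings_strip d0 xx' sy (fun b => fxy _ b (or_introl erefl))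
  (fun b => fxy _ b (or_intror (or_introl erefl))).
move: IH.
by case_booleans.
Qed.

(** Negating the difference exchanges the half axes, so each side change is counted by exactly one
    of the two sums; the parity of the side changes is read off at the ends. *)
Lemma rcrossings_crossings d q x s : 0 < d -> steps (d / 2) x s ->
  (forall a, List.In a (x :: s) -> far d a q) ->
  rcrossings q x s = crossings q x s (+) lexpos (sub2 x q) (+) lexpos (sub2 (last x s) q).
Proof.
move=> d0; elim: s x => [|y s IH] x /= sx fx; first by rewrite addbb.
case: sx => xy sx; rewrite IH //; last by move=> a h; apply: fx; right.
have fx1 := fx _ (or_introl erefl); have fy1 := fx _ (or_intror (or_introl erefl)).
have npq a : far d a q -> a <> q.
  by move=> fa aq; have := dist2xx q d0; rewrite /far aq in fa *; lra.
rewrite /crossing (lexposN (npq _ fx1)) (lexposN (npq _ fy1)).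
have chg := @lexpos_change d (sub2 x q) (sub2 y q) fx1 fy1.
have {}chg : lexpos (sub2 x q) != lexpos (sub2 y q) ->
    above (sub2 q x) = ~~ above (sub2 x q).
  move=> neq; have d20 : 0 < d / 2 by lra.
  have [_] := chg (dist2_sub xy (dist2xx q d20)) neq.
  by rewrite /above /sub2 /=; do ![case: Rlt_dec => ? //=]; lra.
move: chg; case: (lexpos (sub2 x q)); case: (lexpos (sub2 y q)) => //= chg;
  rewrite ?chg //; by case_booleans.
Qed.
Lemma steps_cat d x s t : steps d x (s ++ t) <-> steps d x s /\ steps d (last x s) t.
Proof. by elim: s x => [|y s IH] x /=; [tauto | rewrite IH; tauto]. Qed.

Definition sample (N : nat) (f : R -> pt) : seq pt :=
  [seq f (INR k / INR N) | k <- iota 1 N].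

Lemma sample_last N f x : (0 < N)%N -> last x (sample N f) = f 1.
Proof.
case: N => // N _; rewrite /sample.
have -> : iota 1 N.+1 = rcons (iota 1 N) N.+1 by rewrite -cats1 -[in LHS](addn1 N) iotaD.
by rewrite map_rcons last_rcons; congr f; field; apply: not_0_INR.
Qed.

Lemma in01_div k N : (k <= N)%N -> (0 < N)%N -> in01 (INR k / INR N).
Proof.
move=> kN N0; have N0' : 0 < INR N by apply/lt_0_INR/ltP.
have kN' : INR k <= INR N by apply/le_INR/leP.
have k0 := pos_INR k.
split; first by apply: Rmult_le_pos => //; apply/Rlt_le/Rinv_0_lt_compat.
by apply: (Rmult_le_reg_r (INR N)) => //; field_simplify; lra.
Qed.

Lemma sample_steps N f d : (0 < N)%N ->
  (forall s t, in01 s -> in01 t -> Rabs (t - s) <= / INR N -> dist2 (f s) (f t) < d) ->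
  steps d (f 0) (sample N f).
Proof.
move=> N0 fN.
have N0' : INR N <> 0 by apply: not_0_INR => N0'; rewrite N0' in N0.
suff H n m : (m + n = N)%N ->
    steps d (f (INR m / INR N)) [seq f (INR k / INR N) | k <- iota m.+1 n].
  have := H N 0%N (add0n N); by rewrite /= /Rdiv Rmult_0_l.
elim: n m => [|n IH] m mn //.
have mN : (m < N)%N by rewrite -mn addnS ltnS leq_addr.
refine (conj _ (IH m.+1 _)); last by rewrite addSnnS.
apply: fN; [exact: in01_div (ltnW mN) N0 | exact: in01_div mN N0 |].
rewrite S_INR.
replace ((INR m + 1) / INR N - INR m / INR N) with (/ INR N) by (field; exact: N0').
rewrite Rabs_pos_eq; first exact: Rle_refl.
by apply/Rlt_le/Rinv_0_lt_compat/lt_0_INR/ltP.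
Qed.

Lemma sample_in N f a : (0 < N)%N -> List.In a (sample N f) ->
  exists2 t, in01 t & a = f t.
Proof.
move=> N0; rewrite /sample => /List.in_map_iff [k [<- ]] kN.
exists (INR k / INR N) => //; apply: in01_div => //.
have : k \in iota 1 N.
  elim: (iota 1 N) kN => //= x s IH [->|/IH]; rewrite inE ?eqxx // => ->.
  by rewrite orbT.
by rewrite mem_iota add1n ltnS => /andP [].
Qed.

(** Walks between representatives become polygons sampled from the arcs. For disjoint index pairs
    these stay apart, and [crossings_grid] gives the identities that [pairing_parity] refutes. *)
Lemma planar_no_K5 (T : finType) (e : rel T) : planar e -> ~ clique_model 5 e.
Proof.
case=> pos [arc [pos_inj drawing]] [c [v [cv conn]]].
have [d [d0 sep]] : exists d, 0 < d /\ forall w : T * T * T * T,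
    e w.1.1.1 w.1.1.2 -> e w.1.2 w.2 ->
    w.1.2 \notin [:: w.1.1.1; w.1.1.2] -> w.2 \notin [:: w.1.1.1; w.1.1.2] ->
    forall s t, in01 s -> in01 t ->
      far d (arc w.1.1.1 w.1.1.2 s) (arc w.1.2 w.2 t).
  apply: common_bound => [[[[x y] x'] y'] d d' H le_d' exy ex'y' nx ny s t s01 t01 /=|].
    exact: Rle_trans le_d' (H exy ex'y' nx ny s t s01 t01).
  move=> [[[x y] x'] y'] /=.
  case: (boolP [&& e x y, e x' y', x' \notin [:: x; y] & y' \notin [:: x; y]]);
    last first.
    move=> no; exists 1; split; first lra.
    by move=> exy exy' nx ny; rewrite exy exy' nx ny in no.
  case/and4P=> exy exy' nx ny.
  have [cf [_ [_ [_ [_ disj]]]]] := drawing _ _ exy.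
  have [cg _] := drawing _ _ exy'.
  have [|d [d0 H]] := cont01_separated cf cg; last by exists d; split.
  move=> s t s01 t01 eq_st; case: (disj _ _ exy' _ s t s01 t01 eq_st).
    by case=> -[? ?]; subst; rewrite !inE eqxx ?orbT in nx ny.
  by move=> w [[] ? [[] ? _]]; subst; rewrite !inE eqxx ?orbT in nx ny.
have d20 : 0 < d / 2 by lra.
have [r [r0 unif]] : exists r, 0 < r /\ forall w : T * T, e w.1 w.2 ->
    forall s t, in01 s -> in01 t -> Rabs (t - s) < r ->
      dist2 (arc w.1 w.2 s) (arc w.1 w.2 t) < d / 2.
  apply: common_bound => [[x y] r r' H le_r' exy s t s01 t01 st|[x y]].
    by apply: H => //; lra.
  case: (boolP (e x y)) => exy; last by exists 1; split; [lra|].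
  have [cf _] := drawing _ _ exy.
  by have [r [r0 H]] := cont01_uniform cf d20; exists r.
have [N [N0 Nr]] : exists N, (0 < N)%N /\ / INR N < r.
  have [N [Nr N0]] := archimed_cor1 r r0; exists N; split=> //; exact/ltP.
pose on_arc i j a := exists x y t, [/\ e x y, c x \in [:: Some i; Some j],
  c y \in [:: Some i; Some j], in01 t & a = arc x y t].
have /fin_all_exists [S HS] : forall ij : 'I_5 * 'I_5, exists S, ij.1 != ij.2 ->
    [/\ steps (d / 2) (pos (v ij.1)) S, last (pos (v ij.1)) S = pos (v ij.2) &
        forall a, List.In a (pos (v ij.1) :: S) -> on_arc ij.1 ij.2 a].
  move=> [i j] /=.
  case: (boolP (i == j)) => [_|ij]; first by exists [::].
  have /connectP [s ps lasts] := conn _ _ ij.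
  suff [S [S1 S2 S3]] : exists S : seq pt,
      [/\ steps (d / 2) (pos (v i)) S, last (pos (v i)) S = pos (last (v i) s) &
        (forall a, List.In a S -> on_arc i j a)].
    exists S => _; rewrite S2 -lasts; split=> // a [<-|]; last exact: S3.
    case: s ps lasts {S S1 S2 S3} => [_ /= vji|x s /= /andP [/and3P [vx cvi cx] _ _]].
      by have := cv j; rewrite vji cv => -[ji]; rewrite ji eqxx in ij.
    have [_ [_ [<- _]]] := drawing _ _ vx.
    by exists (v i), x, 0; split=> //; split; lra.
  elim: s (v i) ps {lasts} => [|y s IH] x /=; first by exists [::].
  case/andP=> /and3P [exy cx cy] /IH [S [S1 S2 S3]].
  have [_ [_ [arc0 [arc1 _]]]] := drawing _ _ exy.
  exists (sample N (arc x y) ++ S); rewrite last_cat sample_last // arc1.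
  split=> //.
    rewrite steps_cat sample_last // arc1; split=> //.
    rewrite -arc0; apply: sample_steps => // s1 t1 s01 t01 st.
    by apply: (unif (x, y)) => //; lra.
  move=> a /List.in_app_iff [|]; last exact: S3.
  by case/(sample_in N0) => t t01 ->; exists x, y, t.
pose h i j k := crossings (pos (v k)) (pos (v i)) (S (i, j)).
pose s i j := lexpos (sub2 (pos (v i)) (pos (v j))).
apply: (@pairing_parity h s) => [i j ij | i j k l ijkl].
  apply: lexposN => /pos_inj vij; have := cv i; rewrite vij cv => -[ji].
  by rewrite ji eqxx in ij.
have far_ijkl i' j' k' l' a b : uniq [:: i'; j'; k'; l'] ->
    on_arc i' j' a -> on_arc k' l' b -> far d a b.
  move=> U [x [y [t [exy cx cy t01 ->]]]] [x' [y' [t' [exy' cx' cy' t01' ->]]]].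
  have notin z : c z \in [:: Some k'; Some l'] -> z \notin [:: x; y].
    move=> cz; apply/negP => zxy.
    have : c z \in [:: Some i'; Some j'].
      by move: zxy; rewrite inE => /orP [/eqP -> //|]; rewrite inE => /eqP ->.
    move: U cz; rewrite /= !inE !negb_or.
    case/and4P=> /and3P [_ n1 n2] /andP [n3 n4] _ _.
    by case/orP=> /eqP -> /orP [] /eqP [E]; subst; rewrite eqxx in n1 n2 n3 n4.
  by apply: (sep (x, y, x', y')) => //=; apply: notin.
have [ij kl] : i != j /\ k != l.
  move: ijkl; rewrite /= !inE !negb_or => /and4P [/and3P [-> _ _] _ -> _] //.
have klij : uniq [:: k; l; i; j] by rewrite -(rot_uniq 2).
have [st1 la1 in1] := HS (i, j) ij; have [st2 la2 in2] := HS (k, l) kl.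
have finish i' j' : i' != j' -> List.In (pos (v j')) (pos (v i') :: S (i', j')).
  move=> ij'; have [_ /= <- _] := HS (i', j') ij'.
  elim: (S (i', j')) (pos (v i')) => [|y t IH] x /=; [by left|right; apply: IH].
have := crossings_grid d0 st1 st2
  (fun a b ha hb => far_ijkl i j k l a b ijkl (in1 a ha) (in2 b hb)).
simpl in la1, la2, st1, st2, in1, in2 |- *.
(* Rewriting the two sides along [S (k, l)] by [rcrossings_crossings] produces the four [s]
   terms. *)
rewrite la1 la2 !(rcrossings_crossings d0 st2) /=; last first.
- by move=> a ha; apply: (far_ijkl k l i j) => //;
     [apply: in2 | apply: in1; apply: finish].
- by move=> a ha; apply: (far_ijkl k l i j) => //; [apply: in2 | apply: in1; left].
by rewrite la2 /h /s /=; case_booleans.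
Qed.
End Drawing.

(** * K4 minors in graphs of minimum degree three *)

Section Minors.
Variable T : finType.
Implicit Types (e : rel T) (u v w x y z r s : T).

(** A representative is joined to another one, so it is not isolated; in particular it differs from
    the vertex that [merge] isolates. *)
Lemma clique_model_start n e (c : T -> option 'I_n.+2) (p : 'I_n.+2 -> T) :
  (forall i, c (p i) = Some i) ->
  (forall i j, i != j -> connect (between c e i j) (p i) (p j)) ->
  forall i, exists y, e (p i) y.
Proof.
move=> cp conn i.
have [j ij] : exists j, i != j.
  by case: (eqVneq i ord0) => [->|]; [exists ord_max | exists ord0].
case/connectP: (conn _ _ ij) => [[|y t]] /=.
  by move=> _ pji; have := cp j; rewrite pji cp => -[ij']; rewrite ij' eqxx in ij.
by case/andP => /and3P [epy _ _] _ _; exists y.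
Qed.

Lemma connect_subrel e e' : subrel e e' -> subrel (connect e) (connect e').
Proof. by move=> sub; apply: connect_sub => x y /sub; apply: connect1. Qed.

Lemma clique_model_sub n e e' : subrel e e' -> clique_model n e -> clique_model n e'.
Proof.
move=> sub [c [p [cp conn]]]; exists c, p; split=> // i j /conn.
by apply: connect_subrel => x y /and3P [/sub exy cx cy]; apply/and3P.
Qed.

(** Contraction of [u] into [v] on the same vertex type: [u] becomes isolated, and [x != y] discards
    the loop. *)
Definition merge e u v : rel T := fun x y =>
  [&& x != u, y != u, x != y & [|| e x y, (x == v) && e u y | (y == v) && e x u]].

(** [u] takes the colour of [v], and each new edge at [v] is replaced by a path of two edges through
    [u]. *)
Lemma merge_model n e u v : ssrbool.symmetric e -> u != v -> e u v ->
  clique_model n.+2 (merge e u v) -> clique_model n.+2 e.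
Proof.
move=> e_sym uv euv [c [p [cp conn]]].
pose c' x := if x == u then c v else c x.
have c'v : c' v = c v by rewrite /c' eq_sym (negPf uv).
have c'u : c' u = c v by rewrite /c' eqxx.
exists c', p; split=> [i|i j ij].
  have [y /and3P [pu _ _]] := clique_model_start cp conn i.
  by rewrite /c' (negPf pu).
apply: connect_sub (conn _ _ ij) => x y /and3P [/and4P [xu yu xy exy] cx cy].
have c'x : c' x = c x by rewrite /c' (negPf xu).
have c'y : c' y = c y by rewrite /c' (negPf yu).
case/or3P: exy => [exy | /andP [/eqP xv euy] | /andP [/eqP yv exu]].
- by apply: connect1; rewrite /between exy c'x c'y cx cy.
- subst x; apply: (@connect_trans _ _ u); apply: connect1.
    by rewrite /between e_sym euv c'u c'v cx.
  by rewrite /between euy c'u c'y cx cy.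
- subst y; apply: (@connect_trans _ _ u); apply: connect1.
    by rewrite /between exu c'u c'x cx cy.
  by rewrite /between euv c'u c'v cy.
Qed.

Definition nbrs e x : {set T} := [set y | e x y].

Lemma K4_clique_model e u v w s : ssrbool.symmetric e -> uniq [:: u; v; w; s] ->
  e u v -> e u w -> e u s -> e v w -> e v s -> e w s -> clique_model 4 e.
Proof.
move=> e_sym U euv euw eus evw evs ews.
pose t := [tuple u; v; w; s].
pose c x : option 'I_4 := if x \in t then Some (inord (index x t)) else None.
have ct i : c (tnth t i) = Some i.
  rewrite /c mem_tnth -[in RHS](inord_val i); congr (Some (inord _)).
  by rewrite (tnth_nth u) index_uniq ?size_tuple.
exists c, (tnth t); split=> // i j ij.
apply: connect1; rewrite /between !ct !inE !eqxx orbT !andbT.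
have : all (fun i => all (fun j => (i == j) || e (nth u t i) (nth u t j)) (iota 0 4))
    (iota 0 4).
  rewrite /= euv euw eus evw evs ews !(e_sym v) !(e_sym w) !(e_sym s).
  by rewrite euv euw eus evw evs ews.
move=> /allP /(_ i); rewrite mem_iota ltn_ord => /(_ isT).
move=> /allP /(_ j); rewrite mem_iota ltn_ord => /(_ isT).
by rewrite -!tnth_nth (inj_eq val_inj) (negPf ij).
Qed.

(* Conditions under which merging u into v keeps all degrees outside r at least 3. *)
Definition contractible e r u v :=
  [&& u != r, e u v,
      [forall z, [&& e u z, e v z & z != r] ==> (3 < #|nbrs e z|)] &
      (v == r) || (2 < #|(nbrs e u :|: nbrs e v) :\: [set u; v]|)].

(** [v] gets the joint neighbourhood; a common neighbour loses one of at least four neighbours; a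
    neighbour of [u] alone exchanges [u] for [v]. *)
Lemma contractible_degree e r u v x : ssrbool.symmetric e -> irreflexive e ->
  (forall y z, e y z -> y != r -> 2 < #|nbrs e y|) -> contractible e r u v ->
  x != u -> x != r -> (exists y, e x y) -> 2 < #|nbrs (merge e u v) x|.
Proof.
move=> e_sym e_irr deg3 /and4P [ur euv /forallP common merged] xu xr [y exy].
have uv : u != v by apply: contraTneq euv => ->; rewrite e_irr.
have [xv | xv] := eqVneq x v.
  subst x; rewrite (negPf xr) /= in merged; apply: leq_trans merged _.
  apply/subset_leq_card/subsetP => z; rewrite !inE negb_or => /andP [/andP [zu zv]].
  rewrite /merge xu zu eq_sym zv eqxx /= => /orP [-> | ->]; by rewrite ?orbT.
have dx := deg3 _ _ exy xr.
have sub : nbrs e x :\ u \subset nbrs (merge e u v) x.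
  apply/subsetP => z; rewrite !inE /merge xu => /andP [-> exz].
  by rewrite exz /= andbT; apply: contraTneq exz => ->; rewrite e_irr.
have := cardsD1 u (nbrs e x); rewrite inE => card_x.
case: (boolP (e x u)) card_x => [exu | _] card_x; last first.
  by apply: leq_trans (subset_leq_card sub); rewrite card_x in dx.
case: (boolP (e x v)) => exv.
  have := common x; rewrite (e_sym u) exu (e_sym v) exv xr card_x /= => h.
  by apply: leq_trans (subset_leq_card sub); rewrite -ltnS -add1n.
rewrite card_x in dx; apply: leq_trans dx _.
have vnot : v \notin nbrs e x :\ u by rewrite !inE (negPf exv) andbF.
have <- : #|v |: (nbrs e x :\ u)| = 1 + #|nbrs e x :\ u| by rewrite cardsU1 vnot.
have sub' : v |: (nbrs e x :\ u) \subset nbrs (merge e u v) x;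
  last exact: subset_leq_card sub'.
rewrite subUset sub sub1set inE.
by rewrite /merge xu (eq_sym v) uv xv eqxx exu !orbT.
Qed.

Definition twins e u v w s :=
  [&& e u v, w != s, nbrs e u == [set v; w; s] & nbrs e v == [set u; w; s]].

(** If the condition on common neighbours fails, some [z] has degree exactly 3. Otherwise the joint
    neighbourhood has at most two vertices, while each of [u] and [v] needs two besides the other,
    so both have precisely these. *)
Lemma twins_or_triangle e r u v : ssrbool.symmetric e -> irreflexive e ->
  (forall y z, e y z -> y != r -> 2 < #|nbrs e y|) ->
  u != r -> e u v -> ~~ contractible e r u v ->
  (exists w s, v != r /\ twins e u v w s) \/
  (exists z, [/\ e u z, e v z, z != r & #|nbrs e z| = 3]).
Proof.
move=> e_sym e_irr deg3 ur euv; rewrite /contractible ur euv /= negb_and.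
case/orP=> [|].
  rewrite negb_forall => /existsP [z]; rewrite negb_imply -leqNgt.
  case/andP=> /and3P [euz evz zr] dz; right; exists z; split=> //.
  by apply/eqP; rewrite eqn_leq dz (deg3 z u) // e_sym.
rewrite negb_or -leqNgt => /andP [vr card_uv]; left.
set X := (_ :\: _) in card_uv.
have half a b : e a b -> a != r -> nbrs e a :\ b \subset X ->
    nbrs e a :\ b = X /\ #|X| = 2.
  move=> eab ar sub; have := deg3 _ _ eab ar.
  rewrite (cardsD1 b) inE eab add1n ltnS => h.
  have hX := leq_trans h (subset_leq_card sub).
  split; first by apply/eqP; rewrite eqEcard sub (leq_trans card_uv).
  by apply/eqP; rewrite eqn_leq card_uv.
have [Xu X2] : nbrs e u :\ v = X /\ #|X| = 2.
  apply: half => //.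
  apply/subsetP => z; rewrite !inE => /andP [zv euz].
  by rewrite negb_or zv euz !andbT; apply: contraTneq euz => ->; rewrite e_irr.
have [Xv _] : nbrs e v :\ u = X /\ #|X| = 2.
  apply: half; rewrite 1?e_sym //.
  apply/subsetP => z; rewrite !inE => /andP [zv euz].
  by rewrite negb_or zv euz orbT !andbT; apply: contraTneq euz => ->; rewrite e_irr.
have /cards2P [w [s [ws Xws]]] : #|X| == 2 by rewrite X2.
exists w, s; split=> //; rewrite /twins euv ws /= -!setUA -Xws -{1}Xu -Xv.
by rewrite !setD1K ?inE ?eqxx // e_sym.
Qed.

(** If [u v] does not give twins, it gives [z] with neighbours [u], [v], [t]. If [z t] does not
    either, it gives a common neighbour [x] of degree 3, which must be [u] or [v], and then [x] and
    [z] are twins. *)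
Lemma exists_twins e r u v : ssrbool.symmetric e -> irreflexive e ->
  (forall y z, e y z -> y != r -> 2 < #|nbrs e y|) ->
  u != r -> e u v -> (forall x y, ~~ contractible e r x y) ->
  exists x y w s, [/\ x != r, y != r & twins e x y w s].
Proof.
move=> e_sym e_irr deg3 ur euv noc.
have [[w [s [vr tw]]]|[z [euz evz zr dz]]] :=
  twins_or_triangle e_sym e_irr deg3 ur euv (noc _ _).
  by exists u, v, w, s.
have uv : u != v by apply: contraTneq euv => ->; rewrite e_irr.
have [t Nz] : exists t, nbrs e z :\ u :\ v = [set t].
  apply/cards1P; move: dz; rewrite (cardsD1 u) (cardsD1 v) !inE eq_sym uv.
  by rewrite !(e_sym z) euz evz /= => -[/eqP].
have zt : e z t.
  by have := set11 t; rewrite -Nz !inE => /and3P [].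
have tu : t != u by have := set11 t; rewrite -Nz !inE => /and3P [].
have tv : t != v by have := set11 t; rewrite -Nz !inE => /and3P [].
have {}Nz : nbrs e z = [set u; v; t].
  by rewrite -setUA -Nz !setD1K ?inE ?(eq_sym v) ?uv ?(e_sym z) ?euz ?evz.
have three x a b c : #|nbrs e x| = 3 -> e x a -> e x b -> e x c ->
    a != b -> a != c -> b != c -> nbrs e x = [set a; b; c].
  move=> dx xa xb xc ab ac bc; apply/esym/eqP; rewrite eqEcard dx.
  rewrite -setUA !cardsU1 cards1 !inE negb_or ab ac bc /= andbT.
  by apply/subsetP => y; rewrite !inE => /or3P [] /eqP ->.
have [[w [s [tr tw]]]|[x [ezx etx xr dx]]] :=
  twins_or_triangle e_sym e_irr deg3 zr zt (noc _ _).
  by exists z, t, w, s.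
have irr2 a b : e a b -> a != b by move=> eab; apply: contraTneq eab => ->; rewrite e_irr.
have [eze ezv] : e z u /\ e z v by rewrite !(e_sym z).
have : x \in nbrs e z by rewrite inE.
rewrite Nz !inE => /orP [/orP [] /eqP xE|/eqP xt]; last by rewrite xt e_irr in etx.
  subst x; exists u, z, v, t; split=> //; rewrite /twins euz eq_sym tv Nz eqxx andbT /=.
  by apply/eqP/three; rewrite 1?(eq_sym v) // ?(irr2 _ _ ezv) ?(irr2 _ _ zt) // e_sym.
subst x; exists v, z, u, t; split=> //.
rewrite /twins evz eq_sym tu Nz (setUC [set u]) eqxx andbT /=.
by apply/eqP/three; rewrite 1?(eq_sym u) // ?(irr2 _ _ eze) ?(irr2 _ _ zt) // e_sym.
Qed.

Definition support e : {set T} := [set x | [exists y, e x y]].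

Lemma merge_sym e u v : ssrbool.symmetric e -> ssrbool.symmetric (merge e u v).
Proof.
move=> e_sym x y; rewrite /merge (eq_sym x y) (e_sym x y) (e_sym x u) (e_sym y u).
by case: (x != u); case: (y != u) => //=; rewrite (orbC (_ && _)).
Qed.

(* What remains of merging the twin u into w once the other twin v, now of degree 2,
   is deleted. *)
Definition untwin e u v w s : rel T := fun x y =>
  [&& x \notin [set u; v], y \notin [set u; v] &
      [|| e x y, (x == w) && (y == s) | (x == s) && (y == w)]].

Lemma untwin_merge e u v w s : ssrbool.symmetric e -> irreflexive e ->
  twins e u v w s -> subrel (untwin e u v w s) (merge e u w).
Proof.
move=> e_sym e_irr /and4P [euv ws /eqP Nu _] x y.
have eus : e u s by have : s \in nbrs e u by [rewrite Nu !inE eqxx orbT]; rewrite inE.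
rewrite /untwin /merge !inE !negb_or => /and3P [/andP [-> _] /andP [-> _] /= h].
case/or3P: h => [exy|/andP [/eqP -> /eqP ->]|/andP [/eqP -> /eqP ->]].
- by rewrite exy andbT; apply: contraTneq exy => ->; rewrite e_irr.
- by rewrite ws eqxx eus orbT.
- by rewrite eq_sym ws eqxx (e_sym s u) eus !orbT.
Qed.

(** If [w] had degree 3, with third neighbour [t], then [w t] would be contractible: its ends have
    no common neighbour, and unless [t] is [r] their joint neighbourhood contains [u], [v] and two
    further neighbours of [t]. *)
Lemma twins_degree e r u v w s : ssrbool.symmetric e -> irreflexive e ->
  (forall y z, e y z -> y != r -> 2 < #|nbrs e y|) ->
  u != r -> v != r -> twins e u v w s -> ~~ e w s ->
  (forall x y, ~~ contractible e r x y) ->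
  w != r -> 3 < #|nbrs e w|.
Proof.
move=> e_sym e_irr deg3 ur vr /and4P [euv ws /eqP Nu /eqP Nv] news noc wr.
have Nu' z : e u z = (z \in [set v; w; s]) by rewrite -Nu inE.
have Nv' z : e v z = (z \in [set u; w; s]) by rewrite -Nv inE.
have ewu : e w u by rewrite e_sym Nu' !inE eqxx orbT.
have ewv : e w v by rewrite e_sym Nv' !inE eqxx orbT.
have uv : u != v by apply: contraTneq euv => ->; rewrite e_irr.
rewrite ltnNge; apply/negP => dw.
have {}dw : #|nbrs e w| = 3 by apply/eqP; rewrite eqn_leq dw (deg3 _ _ ewu).
have [t Nw] : exists t, nbrs e w :\ u :\ v = [set t].
  apply/cards1P; move: dw; rewrite (cardsD1 u) (cardsD1 v) !inE eq_sym uv.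
  by rewrite ewu ewv /= => -[/eqP].
have : t \in nbrs e w :\ u :\ v by rewrite Nw set11.
rewrite !inE => /and3P [tv tu ewt].
have ts : t != s by apply: contraNneq news => <-.
have wt : t != w by apply: contraTneq ewt => ->; rewrite e_irr.
have netu : ~~ e t u by rewrite e_sym Nu' !inE !negb_or tv wt ts.
have netv : ~~ e t v by rewrite e_sym Nv' !inE !negb_or tu wt ts.
have {}Nw z : e w z -> z != u -> z != v -> z = t.
  by move=> ewz zu zv; apply/set1P; rewrite -Nw !inE zu zv.
apply: (negP (noc w t)); rewrite /contractible wr ewt /=; apply/andP; split.
  apply/forallP => z; apply/implyP => /and3P [ewz etz _].
  have zu : z != u by apply: contraTneq etz => ->.
  have zv : z != v by apply: contraTneq etz => ->.
  by rewrite (Nw z) // e_irr in etz.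
case: (eqVneq t r) => //= tr.
have dt : 2 < #|nbrs e t| by apply: deg3 tr; rewrite e_sym; exact: ewt.
have : u |: (v |: (nbrs e t :\ w)) \subset (nbrs e w :|: nbrs e t) :\: [set w; t].
  apply/subsetP => z; rewrite !inE negb_or => /or3P [/eqP ->|/eqP ->|/andP [-> etz]].
  - by rewrite ewu (eq_sym u t) tu /= !andbT; apply: contraTneq ewu => ->; rewrite e_irr.
  - by rewrite ewv (eq_sym v t) tv /= !andbT; apply: contraTneq ewv => ->; rewrite e_irr.
  - by rewrite etz orbT /= ?andbT; apply: contraTneq etz => ->; rewrite e_irr.
move/subset_leq_card; apply: leq_trans.
rewrite !cardsU1 !inE (negPf netu) (negPf netv) (negPf uv) !andbF /=.
by move: dt; rewrite (cardsD1 w) inE e_sym ewt !add1n => /leqW.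
Qed.

Lemma twins_swap e u v w s : twins e u v w s -> twins e u v s w.
Proof. by rewrite /twins eq_sym -!setUA (setUC [set w]). Qed.

(** [w] loses [u] and [v] but gains [s], so degree 4 suffices. *)
Lemma untwin_degree e r u v w s : ssrbool.symmetric e -> irreflexive e ->
  twins e u v w s -> ~~ e w s -> (w != r -> 3 < #|nbrs e w|) -> w != r ->
  2 < #|nbrs (untwin e u v w s) w|.
Proof.
move=> e_sym e_irr /and4P [euv ws /eqP Nu /eqP Nv] news dw wr.
have {}dw := dw wr.
have Nu' z : e u z = (z \in [set v; w; s]) by rewrite -Nu inE.
have Nv' z : e v z = (z \in [set u; w; s]) by rewrite -Nv inE.
have neq a b : e a b -> b != a by move=> eab; apply: contraTneq eab => ->; rewrite e_irr.
have [eus evs] : e u s /\ e v s by rewrite Nu' Nv' !inE eqxx !orbT.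
have [euw evw] : e u w /\ e v w by rewrite Nu' Nv' !inE eqxx !orbT.
have [[wu wv] [su sv]] := ((neq _ _ euw, neq _ _ evw), (neq _ _ eus, neq _ _ evs)).
have : s |: (nbrs e w :\ u :\ v) \subset nbrs (untwin e u v w s) w.
  apply/subsetP => z; rewrite /untwin !inE !negb_or wu wv eqxx /=.
  case/orP=> [/eqP -> | /and3P [-> -> ->] //].
  by rewrite su sv eqxx orbT.
move/subset_leq_card; apply: leq_trans.
rewrite cardsU1 !inE (negPf news) !andbF /=; move: dw.
have vu : v != u by apply: neq.
by rewrite (cardsD1 u) (cardsD1 v) !inE vu (e_sym w) euw (e_sym w) evw.
Qed.

(** Induction on the number of non-isolated vertices. Either a contractible edge is merged, or twins
    exist; their neighbours [w] and [s] complete a [K_4] if adjacent, and otherwise the twins are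
    removed and [w], [s] joined. *)
Lemma min_degree_K4 e r : ssrbool.symmetric e -> irreflexive e ->
  (forall x y, e x y -> x != r -> 2 < #|nbrs e x|) ->
  (exists2 x, x != r & exists y, e x y) -> clique_model 4 e.
Proof.
have [n] := ubnP #|support e|.
elim: n e => // n IH e lt_n e_sym e_irr deg3 [x xr [y exy]].
have smaller e' u v : e u v -> support e' \subset support e -> u \notin support e' ->
    #|support e'| < n.
  move=> euv sub ue'; rewrite -ltnS; apply: leq_trans lt_n; rewrite ltnS.
  apply: proper_card; rewrite properE sub; apply/subsetPn; exists u => //.
  by rewrite inE; apply/existsP; exists v.
case: (boolP [exists u, exists v, contractible e r u v]) =>
  [/existsP [u /existsP [v uv_ok]] | noc].
  have /and4P [ur euv _ _] := uv_ok.
  have uv : u != v by apply: contraTneq euv => ->; rewrite e_irr.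
  apply: (@merge_model _ e u v) => //; apply: IH.
  - apply: (smaller _ u v) => //; last first.
      by rewrite inE; apply/negP => /existsP [z /and4P []]; rewrite eqxx.
    apply/subsetP => z; rewrite !inE => /existsP [t /and4P [_ _ _ h]]; apply/existsP.
    case/or3P: h => [ezt|/andP [/eqP -> _]|/andP [_ ezu]]; [by exists t| |by exists u].
    by exists u; rewrite e_sym.
  - exact: merge_sym.
  - by move=> z; rewrite /merge eqxx !andbF.
  - move=> z t mzt zr; apply: (contractible_degree e_sym e_irr deg3 uv_ok) => //.
      by case/and4P: mzt.
    case/and4P: mzt => _ _ _ /or3P [ezt|/andP [/eqP -> _]|/andP [_ ezu]];
      [by exists t| |by exists u].
    by exists u; rewrite e_sym.
  (* A neighbour of [u] other than [r] and [v] becomes adjacent to [v], so some vertex other than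
     [r] keeps an edge. *)
  - have : 0 < #|nbrs e u :\ r :\ v|.
      have := deg3 _ _ euv ur; rewrite (cardsD1 r) (cardsD1 v).
      by case: (_ \in _); case: (_ \in _); case: #|_|.
    case/card_gt0P=> z; rewrite !inE => /and3P [zv zr euz].
    exists z => //; exists v; rewrite /merge zv eqxx (eq_sym v) uv (e_sym z u) euz.
    rewrite !orbT !andbT.
    by apply: contraTneq euz => ->; rewrite e_irr.
have {}noc u v : ~~ contractible e r u v.
  by apply: contra noc => uv_ok; apply/existsP; exists u; apply/existsP; exists v.
have [u [v [w [s [ur vr tw]]]]] := exists_twins e_sym e_irr deg3 xr exy noc.
have /and4P [euv ws /eqP Nu /eqP Nv] := tw.
have Nu' z : e u z = (z \in [set v; w; s]) by rewrite -Nu inE.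
have Nv' z : e v z = (z \in [set u; w; s]) by rewrite -Nv inE.
have neq a b : e a b -> a != b by move=> eab; apply: contraTneq eab => ->; rewrite e_irr.
have [eus evs] : e u s /\ e v s by rewrite Nu' Nv' !inE eqxx !orbT.
have [euw evw] : e u w /\ e v w by rewrite Nu' Nv' !inE eqxx !orbT.
case: (boolP (e w s)) => [ews | news].
  by apply: (@K4_clique_model e u v w s) => //=; rewrite !inE !negb_or !neq.
apply: (@merge_model _ e u w) => //; first exact: neq.
apply: clique_model_sub (untwin_merge e_sym e_irr tw) _.
have unt_ws : untwin e u v w s w s.
  rewrite /untwin !inE !negb_or !eqxx orbT andbT.
  by rewrite !(eq_sym _ u) !(eq_sym _ v) !neq.
have unt_sym : ssrbool.symmetric (untwin e u v w s).
  move=> a b; rewrite /untwin (e_sym a) andbCA; congr [&& _, _ & _ || _].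
  by rewrite orbC andbC (andbC (a == w)).
apply: IH => //.
- apply: (smaller _ u v) => //; last first.
    by rewrite inE; apply/negP => /existsP [z /and3P []]; rewrite !inE eqxx.
  apply/subsetP => z; rewrite !inE => /existsP [t /and3P [_ _ h]]; apply/existsP.
  case/or3P: h => [ezt|/andP [/eqP -> _]|/andP [/eqP -> _]]; first by exists t.
    by exists u; rewrite e_sym.
  by exists u; rewrite e_sym.
- move=> z; rewrite /untwin e_irr /=; apply/negP => /and3P [_ _].
  by case/orP=> /andP [/eqP -> ]; rewrite ?(negPf ws) // eq_sym (negPf ws).
- move=> z t /and3P [zuv _ h] zr.
  have dw := twins_degree e_sym e_irr deg3 ur vr tw news noc.
  case: (eqVneq z w) => [zw | zw].
    by subst z; apply: untwin_degree dw zr.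
  have news' : ~~ e s w by rewrite e_sym.
  have ds := twins_degree e_sym e_irr deg3 ur vr (twins_swap tw) news' noc.
  case: (eqVneq z s) => [zs | zs].
    subst z; have := untwin_degree e_sym e_irr (twins_swap tw) news' ds zr.
    congr (_ < _); apply: eq_card => a; rewrite !inE /untwin; congr [&& _, _ & _ || _].
    by rewrite orbC.
  (* Such a [z] is adjacent to neither twin and so keeps all its neighbours. *)
  have ezt : e z t by move: h; rewrite (negPf zw) (negPf zs) !orbF.
  apply: leq_trans (deg3 _ _ ezt zr) _.
  have sub : nbrs e z \subset nbrs (untwin e u v w s) z; last exact: subset_leq_card sub.
  apply/subsetP => a; rewrite /untwin !inE => eza; rewrite eza andbT.
  move: zuv; rewrite !inE => zuv; rewrite zuv /=.
  move: zuv; rewrite negb_or => /andP [zu zv].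
  apply/norP; split; apply: contraTneq eza => ->; rewrite e_sym ?Nu' ?Nv' !inE.
    by rewrite (negPf zv) (negPf zw) (negPf zs).
  by rewrite (negPf zu) (negPf zw) (negPf zs).
- case: (eqVneq w r) => [wr | wr]; last by exists w => //; exists s.
  by exists s; [rewrite -wr eq_sym | exists w; rewrite unt_sym].
Qed.

End Minors.

(** * The vertex order and the forest *)

Section Peeling.
Variables (T : finType) (e : rel T).
Hypotheses (e_sym : ssrbool.symmetric e) (e_irr : irreflexive e).
Implicit Types (S : {set T}) (u v w x y : T).

Definition induced S : rel T := fun x y => [&& x \in S, y \in S & e x y].

Definition exposed S : {set T} := [set u | (u \notin S) && [exists w in S, e w u]].

(** Weaker than connectivity of [S]: vertices without outside neighbours are ignored, so exhausted
    components may remain in [S]. *)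
Definition linked S := forall w w' u u', w \in S -> w' \in S ->
  u \notin S -> u' \notin S -> e w u -> e w' u' -> connect (induced S) w w'.

Lemma exposedP S u : reflect (u \notin S /\ exists2 w, w \in S & e w u) (u \in exposed S).
Proof.
rewrite inE; apply: (iffP andP) => -[uS].
  by case/exists_inP => w; split=> //; exists w.
by case=> w wS ewu; split=> //; apply/exists_inP; exists w.
Qed.

(** [S] supplies the fifth class: by [linked], neighbours in [S] of the other four representatives
    are joined to [s] inside [S]. *)
Lemma exposed_K5 S : linked S -> exposed S != set0 ->
  (forall v, v \in exposed S -> 2 < #|nbrs e v :&: exposed S|) -> clique_model 5 e.
Proof.
set B := exposed S => linkS /set0Pn [r rB] degB.
have nbrsB v : v \in B -> nbrs (induced B) v = nbrs e v :&: B.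
  by move=> vB; apply/setP => u; rewrite inE in_setI inE /induced vB /= andbC.
have [c [p [cp conn]]] : clique_model 4 (induced B).
  apply: (@min_degree_K4 _ _ r).
  - by move=> x y; rewrite /induced e_sym andbCA.
  - by move=> x; rewrite /induced e_irr !andbF.
  - by move=> x y /and3P [xB _ _] _; rewrite nbrsB ?degB.
  - have /card_gt0P [x] : 0 < #|nbrs e r :&: B| by apply: leq_trans (degB r rB).
    rewrite in_setI inE => /andP [erx xB]; exists x.
      by apply: contraTneq erx => ->; rewrite e_irr.
    by exists r; rewrite /induced xB rB e_sym.
have pB i : p i \in B by have [y /and3P []] := clique_model_start cp conn i.
have notS x : x \in B -> x \notin S by case/exposedP.
have [_ [s sS esr]] := exposedP _ _ rB.
(* [lift ord_max] embeds the four old colours and leaves [ord_max] for [S]. *)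
pose c' x : option 'I_5 := if x \in S then Some ord_max else
  if x \in B then omap (lift ord_max) (c x) else None.
pose p' i := if unlift ord_max i is Some j then p j else s.
have c'B x : x \in B -> c' x = omap (lift ord_max) (c x).
  by move=> xB; rewrite /c' (negPf (notS _ xB)) xB.
have c'S x : x \in S -> c' x = Some ord_max by rewrite /c' => ->.
have inS a x y : connect (induced S) x y ->
    connect (between c' e (lift ord_max a) ord_max) x y /\
    connect (between c' e ord_max (lift ord_max a)) x y.
  by move=> xy; split; apply: connect_subrel xy => z t /and3P [zS tS ezt];
     rewrite /between ezt !c'S // !inE eqxx ?orbT.
have p'lift a : p' (lift ord_max a) = p a by rewrite /p' liftK.
have p'max : p' ord_max = s by rewrite /p' unlift_none.
exists c', p'; split=> [i|i j].
  case: (unliftP ord_max i) => [a ->|->]; first by rewrite p'lift c'B // cp.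
  by rewrite p'max c'S.
case: (unliftP ord_max i) => [a ->|->]; case: (unliftP ord_max j) => [b ->|->].
- rewrite (inj_eq (@lift_inj _ _)) !p'lift => /conn; apply: connect_subrel => x y.
  case/and3P=> /and3P [xB yB exy] cx cy; rewrite /between exy !c'B //=.
  have lifted z : c z \in [:: Some a; Some b] ->
      omap (lift ord_max) (c z) \in [:: Some (lift ord_max a); Some (lift ord_max b)].
    by rewrite !inE => /orP [] /eqP ->; rewrite eqxx ?orbT.
  by rewrite !lifted.
- move=> _; rewrite p'lift p'max; have [pS [w wS ewp]] := exposedP _ _ (pB a).
  have [ws _] := inS a _ _ (linkS w s (p a) r wS sS pS (notS _ rB) ewp esr).
  apply: connect_trans (connect1 _) ws.
  by rewrite /between e_sym ewp (c'B _ (pB a)) cp c'S // !inE !eqxx orbT.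
- move=> _; rewrite p'lift p'max; have [pS [w wS ewp]] := exposedP _ _ (pB b).
  have [_ sw] := inS b _ _ (linkS s w r (p b) sS wS (notS _ rB) pS esr ewp).
  apply: connect_trans sw (connect1 _).
  by rewrite /between ewp (c'B _ (pB b)) cp c'S // !inE !eqxx orbT.
- by rewrite eqxx.
Qed.

Hypothesis noK5 : ~ clique_model 5 e.

Lemma next_vertex S v0 : linked S -> v0 \notin S ->
  exists v, [/\ v \notin S, #|nbrs e v :&: exposed S| <= 2 & linked (v |: S)].
Proof.
move=> linkS v0S; have [B0 | Bn0] := eqVneq (exposed S) set0.
  exists v0; split=> //; first by rewrite B0 setI0 cards0.
  (* No edge leaves [S], so in [v0 |: S] only [v0] can have an outside neighbour. *)
  have only w u : w \in v0 |: S -> u \notin v0 |: S -> e w u -> w = v0.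
    rewrite !inE negb_or => /orP [/eqP //|wS] /andP [_ uS] ewu.
    have : u \in exposed S by apply/exposedP; split=> //; exists w.
    by rewrite B0 inE.
  by move=> w w' u u' wS w'S uS u'S ewu ewu'; rewrite (only w u) // (only w' u').
have [v vB dv] : exists2 v, v \in exposed S & #|nbrs e v :&: exposed S| <= 2.
  apply/exists_inP; apply: contra_notT noK5; rewrite negb_exists => /forallP all3.
  apply: (exposed_K5 linkS Bn0) => v vB.
  by have := all3 v; rewrite vB /= -ltnNge.
have [vS [w0 w0S ew0]] := exposedP _ _ vB; exists v; split=> //.
(* All connections pass through [w0], a neighbour of [v] in [S]; [v] itself is the outside neighbour
   of [w0] that [linkS] asks for. *)
have to_w0 w u : w \in v |: S -> u \notin v |: S -> e w u ->
    connect (induced (v |: S)) w w0 /\ connect (induced (v |: S)) w0 w.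
  rewrite !inE negb_or => /orP [/eqP ->|wS] /andP [uv uS] ewu.
    by split; apply: connect1; rewrite /induced !inE eqxx w0S orbT // e_sym.
  have sub : subrel (induced S) (induced (v |: S)).
    by move=> x y /and3P [xS yS exy]; rewrite /induced !inE xS yS exy !orbT.
  by split; apply: connect_subrel sub _ _ _; 
    [apply: (linkS w w0 u v) | apply: (linkS w0 w v u)].
move=> w w' u u' wS w'S uS u'S ewu ewu'.
by apply: connect_trans (to_w0 _ _ wS uS ewu).1 (to_w0 _ _ w'S u'S ewu').2.
Qed.

(** The set consists of the neighbours of [v] that are exposed at the moment when [v] is listed. *)
Lemma peeling_order : exists pos : T -> nat, injective pos /\ forall v,
  #|[set u | [&& e v u, pos v < pos u & [exists w, e w u && (pos w < pos v)]]]| <= 2.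
Proof.
(* An unlisted vertex has index [size s], beyond every listed one, so [out s] is meaningful for
   partial lists. *)
pose out s v := [set u | [&& e v u, index v s < index u s &
  [exists w, e w u && (index w s < index v s)]]].
suff H n : n <= #|T| -> exists s : seq T, [/\ size s = n, uniq s,
    linked [set x in s] & forall v, v \in s -> #|out s v| <= 2].
  have [s [size_s uniq_s _ out_s]] := H #|T| (leqnn _).
  have all_s x : x \in s.
    have : [set x in s] = setT.
      apply/eqP; rewrite eqEcard subsetT cardsT cardsE (card_uniqP uniq_s) size_s.
      exact: leqnn.
    by move/setP/(_ x); rewrite !inE.
  exists (index^~ s); split=> [x y|v]; last exact: out_s.
  by move/(congr1 (nth x s)); rewrite !nth_index.
elim: n => [_|n IH ltn].
  by exists [::]; split=> // w w' u u'; rewrite !inE.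
have [s [size_s uniq_s link_s out_s]] := IH (ltnW ltn).
have [v0 v0s] : exists v0, v0 \notin [set x in s].
  apply/existsP; rewrite -negb_forall; apply: contraTN ltn => /forallP all_s.
  rewrite -leqNgt -size_s -(card_uniqP uniq_s); apply/subset_leq_card/subsetP => x _.
  by have := all_s x; rewrite inE.
have [v [vs dv link_v]] := next_vertex link_s v0s.
rewrite inE in vs.
have index_old x : x \in s -> index x (rcons s v) = index x s.
  by move=> xs; rewrite -cats1 index_cat xs.
have index_v : index v (rcons s v) = n.
  by rewrite -cats1 index_cat (negPf vs) /= eqxx addn0.
have index_new x : x \notin s -> x != v -> index x (rcons s v) = n.+1.
  by move=> xs xv; rewrite -cats1 index_cat (negPf xs) /= eq_sym (negPf xv) size_s addn1.
have lt_old x : (index x (rcons s v) < n) = (x \in s).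
  case: (boolP (x \in s)) => xs; first by rewrite index_old // -size_s index_mem.
  by have [->|xv] := eqVneq x v; rewrite ?index_v ?index_new ?ltnn // ltnNge leqW.
have lt_s x y : x \in s ->
    (index x (rcons s v) < index y (rcons s v)) = (index x s < index y s).
  move=> xs; rewrite index_old //; case: (boolP (y \in s)) => ys.
    by rewrite index_old.
  rewrite (memNindex ys); have xn : index x s < n by rewrite -size_s index_mem.
  rewrite size_s xn; have [->|yv] := eqVneq y v;
    by rewrite ?index_v ?index_new // ltnS ltnW.
exists (rcons s v); split.
- by rewrite size_rcons size_s.
- by rewrite rcons_uniq vs.
- have -> // : [set x in rcons s v] = v |: [set x in s].
  by apply/setP => x; rewrite !inE mem_rcons inE.
- move=> x; rewrite mem_rcons inE; case: (boolP (x \in s)) => [xs _ | xs].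
    apply: leq_trans (out_s x xs); apply/subset_leq_card/subsetP => u.
    rewrite !inE lt_s // => /and3P [-> -> /existsP [w /andP [ewu wx]]].
    apply/existsP; exists w; rewrite ewu -lt_s //.
    by rewrite -lt_old; apply: ltn_trans wx _; rewrite lt_old.
  rewrite orbF => /eqP ->; apply: leq_trans dv; apply/subset_leq_card/subsetP => u.
  rewrite !inE index_v => /and3P [-> un /existsP [w /andP [ewu]]].
  rewrite lt_old => ws /=; apply/andP; split.
    by rewrite -lt_old -leqNgt ltnW.
  by apply/exists_inP; exists w; rewrite ?inE.
Qed.

End Peeling.

(** * Acyclicity of the first-neighbour edges *)

Section Forest.
Variables (T : finType) (e : rel T) (pos : T -> nat).

Definition first_nbr w u :=
  [&& e w u, pos w < pos u & ~~ [exists z, e z u && (pos z < pos w)]].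

Definition exposing : rel T := fun x y => first_nbr x y || first_nbr y x.

Lemma exposing_forest : ssrbool.symmetric e -> injective pos -> forest_in e exposing.
Proof.
move=> e_sym pos_inj; split.
- by move=> x y; rewrite /exposing orbC.
- by move=> x y; rewrite /exposing => /orP [] /and3P []; rewrite // e_sym.
case=> s [size_s uniq_s cyc].
have [x0 x0s] : exists x, x \in s.
  by case: s size_s {uniq_s cyc} => // x s; exists x; rewrite mem_head.
(* At the latest vertex [m] of the cycle both cycle edges come from earlier vertices, so both would
   join [m] to its first neighbour. *)
case: (@arg_maxnP _ x0 (mem s) pos x0s) => m ms max_m.
have [k t rot_s] := rot_to ms.
have uniq_t : uniq (m :: t) by rewrite -rot_s rot_uniq.
have mem_t x : x \in t -> pos x < pos m.
  move=> xt; have xs : x \in s by rewrite -(mem_rot k) rot_s inE xt orbT.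
  rewrite ltn_neqAle (max_m x xs : pos x <= pos m) andbT.
  apply: contraTneq xt => /pos_inj ->.
  by case/andP: uniq_t.
have cyc_t : cycle exposing (m :: t) by rewrite -rot_s rot_cycle.
have : 1 < size t by rewrite -ltnS -[(size t).+1]/(size (m :: t)) -rot_s size_rot.
case: t uniq_t mem_t cyc_t {rot_s} => [|a [|b t]] // uniq_t mem_t cyc_t _.
have {cyc_t} [ma lm] : exposing m a /\ exposing (last b t) m.
  by move: cyc_t; rewrite /= rcons_path => /and3P [-> _ /andP [_ ->]].
have lt : last b t \in b :: t by apply: mem_last.
have al : a != last b t.
  by apply: contraTneq lt => <-; case/and3P: uniq_t.
have first x : x \in [:: a, b & t] -> exposing x m -> first_nbr x m.
  by move=> /mem_t xm /orP [//|/and3P [_ mx _]]; rewrite ltnNge ltnW in mx.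
have fa : first_nbr a m by apply: first; rewrite ?mem_head // /exposing orbC.
have fl : first_nbr (last b t) m by apply: first; rewrite // inE lt orbT.
have minimal x y : first_nbr x m -> first_nbr y m -> pos x <= pos y.
  case/and3P=> _ _ nx /and3P [eym _ _]; rewrite leqNgt; apply: contra nx => yx.
  by apply/existsP; exists y; rewrite eym.
by case/eqP: al; apply/pos_inj/eqP; rewrite eqn_leq !minimal.
Qed.

(** If [v u] is no forest edge, [v] is not the first neighbour of the later vertex [u], so [u] has a
    neighbour before [v]. *)
Lemma remaining_out v : 
  [set u | remove_edges e exposing v u && (pos v < pos u)] \subset
  [set u | [&& e v u, pos v < pos u & [exists w, e w u && (pos w < pos v)]]].
Proof.
apply/subsetP => u; rewrite !inE /remove_edges => /andP [/andP [evu nf] vu].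
rewrite evu vu; apply: contraNT nf => nz.
by rewrite /exposing /first_nbr evu vu nz.
Qed.
End Forest.

(** * The leading monomial of the graph polynomial *)

Section AcyclicOrientation.
Variables (T : finType) (e : rel T) (pos : T -> nat).
Hypotheses (e_sym : ssrbool.symmetric e) (e_irr : irreflexive e).
Hypothesis pos_inj : injective pos.

Definition out v := #|[set u | e v u && (pos v < pos u)%N]|.

(** Positions are compressed to an initial segment so that they define a permutation of the
    variables. *)
Let rank v := #|[set u | (pos u < pos v)%N]|.

Lemma rank_lt v : (rank v < #|T|)%N.
Proof.
rewrite /rank -cardsT; apply: proper_card; rewrite properE subsetT.
by apply/subsetPn; exists v; rewrite !inE ?ltnn.
Qed.

Lemma rank_mono u v : (pos u < pos v)%N -> (rank u < rank v)%N.
Proof.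
move=> uv; apply: proper_card; rewrite properE; apply/andP; split.
  by apply/subsetP => w; rewrite !inE => wu; apply: ltn_trans uv.
by apply/subsetPn; exists u; rewrite !inE ?ltnn.
Qed.

Lemma rank_inj : injective rank.
Proof.
move=> u v ruv; apply: pos_inj.
by case: (ltngtP (pos u) (pos v)) => // /rank_mono; rewrite ruv ltnn.
Qed.

Lemma sigma_inj : injective (fun i : 'I_#|T| => Ordinal (rank_lt (enum_val i))).
Proof. by move=> i j [/rank_inj /enum_val_inj]. Qed.

(** Renaming by [sigma] makes the variables of earlier vertices larger in the monomial order. *)
Let sigma : 'S_#|T| := perm sigma_inj.

Lemma sigmaE v : sigma (enum_rank v) = Ordinal (rank_lt v).
Proof. by rewrite permE; apply: val_inj; rewrite /= enum_rankK. Qed.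

Local Open Scope ring_scope.
Import Order.TTheory GRing.Theory.

(* In the monomial order of mpoly the first variable is the largest one. *)
Lemma ltU n (i j : 'I_n) : (i < j)%N -> (U_(j)%MM < U_(i)%MM :> 'X_{1..n})%O.
Proof.
move=> ij; apply/ltmcP; first by rewrite !mdeg1.
exists i => [k ki|]; rewrite !mnm1E.
  by rewrite -!(inj_eq val_inj) /= !gtn_eqF // (ltn_trans ki).
by rewrite eqxx -(inj_eq val_inj) gtn_eqF.
Qed.

Lemma mlead_sub n (i j : 'I_n) : i != j ->
  mlead ('X_i - 'X_j : {mpoly int[n]}) = U_(if (i < j)%N then i else j)%MM.
Proof.
move=> ij; have [lt|lt|eq] := ltngtP i j; last by rewrite (val_inj eq) eqxx in ij.
  by rewrite mleadDl ?mleadN !mleadXm // ltU.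
by rewrite mleadDr ?mleadN !mleadXm // ltU.
Qed.

Lemma sub_neq0 n (i j : 'I_n) : i != j -> 'X_i - 'X_j != 0 :> {mpoly int[n]}.
Proof.
move=> ij; rewrite -mleadc_eq0 mlead_sub //.
rewrite mcoeffB !mcoeffXU; have [lt|lt|eq] := ltngtP i j.
- by rewrite eqxx (eq_sym j) (negPf ij).
- by rewrite eqxx (negPf ij).
- by rewrite (val_inj eq) eqxx in ij.
Qed.

(** After renaming, each edge factor is led by the variable of its earlier end. Leading monomials
    multiply over [int], so their product has a nonzero coefficient, and its exponents count
    out-edges. *)
Lemma graph_poly_out : (graph_poly e)@_(mono_of out) != 0.
Proof.
pose Q (p : T * T) := (enum_rank p.1 < enum_rank p.2)%N && e p.1 p.2.
pose F (p : T * T) : {mpoly int[#|T|]} :=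
  'X_(sigma (enum_rank p.2)) - 'X_(sigma (enum_rank p.1)).
have msymP : msym sigma (graph_poly e) = \prod_(p | Q p) F p.
  rewrite /graph_poly pair_big_dep /= rmorph_prod /=; apply: eq_bigr => p _.
  by rewrite rmorphB /= /msym !mmapX !mmap1U.
have neq p : Q p -> sigma (enum_rank p.2) != sigma (enum_rank p.1).
  case/andP=> _ epp; rewrite (inj_eq perm_inj) (inj_eq enum_rank_inj).
  by apply: contraTneq epp => ->; rewrite e_irr.
pose tail (p : T * T) := if (pos p.2 < pos p.1)%N then p.2 else p.1.
have lead p : Q p -> mlead (F p) = U_(sigma (enum_rank (tail p)))%MM.
  move=> Qp; rewrite mlead_sub ?neq // !sigmaE /= /tail.
  case: (ltngtP (pos p.2) (pos p.1)) => [lt|lt|eq].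
  - by rewrite rank_mono // sigmaE.
  - by rewrite ltnNge ltnW ?rank_mono // sigmaE.
  - by have := neq p Qp; rewrite (pos_inj eq) eqxx.
have nz : \prod_(p | Q p) F p != 0.
  by apply/prodf_neq0 => p Qp; apply/sub_neq0/neq.
have mlead_msym : mlead (\prod_(p | Q p) F p) =
    (\sum_(p | Q p) U_(sigma (enum_rank (tail p))))%MM.
  rewrite mlead_prod => [|p _ Qp]; last exact/sub_neq0/neq.
  exact: eq_bigr.
(* [mcoeff_sym] carries the renaming from the polynomial over to the monomial. *)
suff -> : mono_of out = [multinom (mlead (\prod_(p | Q p) F p)) (sigma i) | i < #|T|].
  by rewrite -mcoeff_sym msymP mleadc_eq0.
apply/mnmP => i; rewrite !mnmE mlead_msym mnm_sumE.
rewrite -[i]enum_valK enum_rankK; move: (enum_val i) => x {i}.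
under eq_bigr => p _ do rewrite mnm1E (inj_eq perm_inj) (inj_eq enum_rank_inj).
rewrite -big_mkcondr sum1_card /out.
(* The product lists each edge once, smaller [enum_rank] first; [g] turns an out-neighbour of [x]
   into that pair. *)
pose g u := if (enum_rank x < enum_rank u)%N then (x, u) else (u, x).
have g_inj : {in [set u | e x u && (pos x < pos u)%N] &, injective g}.
  apply: (can_in_inj (g := fun p => if p.1 == x then p.2 else p.1)) => u.
  rewrite inE /g => /andP [exu _]; case: (_ < _)%N => /=; first by rewrite eqxx.
  by case: eqP exu => // ->; rewrite e_irr.
rewrite -(card_in_imset g_inj); apply: eq_card => -[u v].
rewrite -[RHS]topredE /= /Q /tail /=; apply/imsetP/idP => [[w]|].
  rewrite inE /g => /andP [exw xw].
  have wx : w != x by apply: contraTneq exw => ->; rewrite e_irr.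
  case: ifP => lt [-> ->].
    by rewrite lt exw /= (ltnNge (pos w)) (ltnW xw) /= eqxx.
  rewrite e_sym exw xw eqxx !andbT ltn_neqAle leqNgt lt andbT.
  by rewrite (inj_eq val_inj) (inj_eq enum_rank_inj).
case/andP=> /andP [ruv euv]; case: ifP => [vu|uv] /eqP xE; subst x.
  exists u; rewrite ?inE /g; first by rewrite e_sym euv vu.
  by rewrite ltnNge (ltnW ruv).
exists v; rewrite ?inE /g ?ruv // euv ltn_neqAle leqNgt uv andbT /=.
by rewrite (inj_eq pos_inj); apply: contraTneq euv => ->; rewrite e_irr.
Qed.
End AcyclicOrientation.

Theorem theorem8 (T : finType) (e : rel T) :
  simple_graph e -> planar e ->
  exists f : rel T, forest_in e f /\
    (alon_tarsi_number (remove_edges e f) <= 3)%N.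
Proof.
case=> e_sym e_irr /planar_no_K5 noK5.
have [pos [pos_inj back2]] := peeling_order e_sym e_irr noK5.
exists (exposing e pos); have [f_sym sub acyc] := exposing_forest e_sym pos_inj.
split; first by split.
set h := remove_edges e _.
have h_sym : ssrbool.symmetric h by move=> x y; rewrite /h /remove_edges e_sym f_sym.
have h_irr : irreflexive h by move=> x; rewrite /h /remove_edges e_irr.
have out3 v : (out h pos v < 3)%N.
  by rewrite ltnS; apply: leq_trans (back2 v); apply/subset_leq_card/remaining_out.
have ok3 : AT_ok h 3.
  apply/existsP; exists [ffun v => Ordinal (out3 v)].
  rewrite (_ : mono_of _ = mono_of (out h pos)) ?graph_poly_out //.
  by apply/mnmP => i; rewrite !mnmE ffunE.
(* [AT_bound T] is the default value of the minimum: if it is at most 2 it already bounds the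
   result, and otherwise 3 lies in the search range. *)
rewrite /alon_tarsi_number; case: (ltnP 2 (AT_bound T)) => bound.
  pose i3 : 'I_(AT_bound T).+1 := Ordinal (bound : 3 < (AT_bound T).+1).
  have : i3 \in index_enum 'I_(AT_bound T).+1 by rewrite mem_index_enum.
  elim: (index_enum _) => // i s IH; rewrite big_cons inE.
  case/orP=> [/eqP <- | /IH le3]; first by rewrite ok3; apply: geq_minl.
  by case: ifP => // _; apply: leq_trans le3; apply: geq_minr.
apply: leq_trans (leqW bound).
by elim/big_rec: _ => // i x _ le_x; apply: leq_trans le_x; apply: geq_minr.
Qed.
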